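(* Let $R$ be a (not-necessarily-commutative) ring, and let $A=(a_{ij})$ and $B=(b_{ij})$ be $m\times n$ matrices with elements in $R$. Suppose that for all $i,k\in[m]$ and $j,l\in[n]$ $$[a_{ij},b_{kl}]=-\delta_{ik}h_{jl},$$ where $(h_{jl})_{j,l=1}^n$ are elements of $R$. Then, for any $I,J\subseteq[n]$ of cardinality $|I|=|J|=r$ (with $1\le r\le n$), writing $I=\{i_1<\dots<i_r\}$ and $J=\{j_1<\dots<j_r\}$: (a) If $A$ has column-symmetric commutators, then $$2\sum_{L\subseteq[m],\,|L|=r}\bigl(\text{col-det}\,(A^{\mathrm T})_{IL}\bigr)\bigl(\text{col-det}\,B_{LJ}\bigr)=2\,\text{col-det}\bigl[(A^{\mathrm T}B)_{IJ}+Q_{\rm col}\bigr],$$ where $(Q_{\rm col})_{\alpha\beta}=(r-\beta)\,h_{i_\alpha j_\beta}$ for $1\le\alpha,\beta\le r$. (b) If $B$ has column-symmetric commutators, then $$2\sum_{L\subseteq[m],\,|L|=r}\bigl(\text{row-det}\,(A^{\mathrm T})_{IL}\bigr)\bigl(\text{row-det}\,B_{LJ}\bigr)=2\,\text{row-det}\bigl[(A^{\mathrm T}B)_{IJ}+Q_{\rm row}\bigr],$$ where $(Q_{\rm row})_{\alpha\beta}=(\alpha-1)\,h_{i_\alpha j_\beta}$ for $1\le\alpha,\beta\le r$.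
   Context: Notation: $[n]=\{1,\dots,n\}$; $[x,y]=xy-yx$; $M_{IJ}$ is the submatrix of $M$ with rows $I$ and columns $J$ kept in their original (increasing) order; empty sums are $0$. $\delta_{ik}h_{jl}$ means $h_{jl}$ if $i=k$ and $0$ otherwise. For an $r\times r$ matrix $M$ over a ring, $\text{col-det}\,M=\sum_{\sigma\in\mathcal S_r}\mathrm{sgn}(\sigma)\,M_{\sigma(1)1}M_{\sigma(2)2}\cdots M_{\sigma(r)r}$ and $\text{row-det}\,M=\sum_{\sigma\in\mathcal S_r}\mathrm{sgn}(\sigma)\,M_{1\sigma(1)}M_{2\sigma(2)}\cdots M_{r\sigma(r)}$. A (not necessarily square) matrix $M$ has column-symmetric commutators if $[M_{ij},M_{kl}]=[M_{il},M_{kj}]$ for all $i,j,k,l$. *)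

(* Defs.v *)
From HB Require Import structures.
From mathcomp Require Import all_boot all_order all_algebra all_fingroup.

Set Implicit Arguments.
Unset Strict Implicit.
Unset Printing Implicit Defensive.

Import GRing.Theory.
Local Open Scope ring_scope.

Definition rbracket (R : pzRingType) (x y : R) : R := x * y - y * x.

(* [\prod_(i < r)] multiplies from left to right in increasing order of [i],
   so these are the ordered determinants over a noncommutative ring. *)
Definition col_det (R : pzRingType) (r : nat) (M : 'M[R]_r) : R :=
  \sum_(s : 'S_r) (-1) ^+ s * \prod_(i < r) M (s i) i.

Definition row_det (R : pzRingType) (r : nat) (M : 'M[R]_r) : R :=
  \sum_(s : 'S_r) (-1) ^+ s * \prod_(i < r) M i (s i).

Definition column_symmetric_commutators (R : pzRingType) (m n : nat)
    (M : 'M[R]_(m, n)) : Prop :=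
  forall (i k : 'I_m) (j l : 'I_n),
    rbracket (M i j) (M k l) = rbracket (M i l) (M k j).

Definition rsubset (n r : nat) := {I : {set 'I_n} | #|I| == r}.

HB.instance Definition _ (n r : nat) := SubFinite.on (rsubset n r).

(* The increasing enumeration of [I]: [enum] lists a set of ordinals in
   increasing order. *)
Definition elt (n r : nat) (I : rsubset n r) (a : 'I_r) : 'I_n :=
  enum_val (cast_ord (esym (eqP (valP I))) a).

Definition submat (R : pzRingType) (m n r : nat) (M : 'M[R]_(m, n))
    (I : rsubset m r) (J : rsubset n r) : 'M[R]_r :=
  mxsub (elt I) (elt J) M.

(* Indices in ['I_r] start at 0, so column [b] carries the factor
   [r - (b + 1)] and row [a] the factor [a]. *)
Definition Qcol (R : pzRingType) (n r : nat) (h : 'M[R]_n)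
    (I J : rsubset n r) : 'M[R]_r :=
  \matrix_(a, b) (h (elt I a) (elt J b) *+ (r - b.+1)).

Definition Qrow (R : pzRingType) (n r : nat) (h : 'M[R]_n)
    (I J : rsubset n r) : 'M[R]_r :=
  \matrix_(a, b) (h (elt I a) (elt J b) *+ a).

(* Main.v *)
Require Import Defs.
From mathcomp Require Import all_boot all_order all_algebra all_fingroup.

Set Implicit Arguments.
Unset Strict Implicit.
Unset Printing Implicit Defensive.

Import GRing.Theory.
Local Open Scope ring_scope.

(** The column determinant of [M] is the Leibniz sum [\det M^T], whose products
    run through the rows in increasing order; so everything below is about
    [\det] over a noncommutative ring.  Write [D l i] for [\det (mxsub l i A)],
    where [l] and [i] are arbitrary sequences of row and column indices.

    The symmetry of the commutators of [A] gives the quadratic relation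
      A a p * A b q - A a q * A b p = - (A b p * A a q - A b q * A a p),
    which says that exchanging two neighbouring rows changes the sign of the
    ordered determinant.  So [D l i] is antisymmetric in [l] ([det_row_perm]).
    A repeated row then gives [D l i = - D l i], that is [2 * D l i = 0]: this
    is one source of the factor 2.  Expanding [col_det B_LJ] and using
    antisymmetry, the sum over the subsets [L] becomes the sum over all
    sequences [l] of [D l i * \prod_b B (l b) (j b)]
    ([sum_injective_ffun], [capelli_cauchy_binet]).

    That sum is evaluated by induction on [r] ([sum_det_mulB]).  Expand [D]
    along its first row and move the factor [B (l 0) (j 0)] to the left, next
    to the entry [A (l 0) (i p)].  The main part produces the entry of
    [A^T *m B].  Each of the [r - 1] rows that was crossed leaves a determinant
    in which this row is replaced by the row [h (i _) (j 0)] and the first row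
    is a copy of the crossed one.  The Jacobi identity shows that the row of
    [h] satisfies the same quadratic relation with the rows of [A], up to a
    factor 2 ([bracket_h_exchange]); so the row of [h] can be exchanged with
    the first row, and the sign of this exchange cancels the sign of the
    commutator.  Every crossing thus contributes the same determinant with
    first row [h (i _) (j 0)], and together they give the correction
    [(r - 1) h] of the first column ([det_mxsub_mulB]).

    The row version is the column version over the converse ring with [A] and
    [B] exchanged, [h] transposed, and all orders reversed ([det_converse]). *)

(** * Ordered determinants with exchangeable rows *)

Lemma lift_perm0_bij r :
  bijective (fun u : 'I_r.+1 * 'S_r => lift_perm ord0 u.1 u.2).
Proof.
apply: inj_card_bij => [[p s] [q t] /= eq_st|]; last first.
  by rewrite card_prod !card_Sn card_ord factS.
have eq_pq: p = q by rewrite -(lift_perm_id ord0 p s) eq_st lift_perm_id.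
rewrite -eq_pq in eq_st *; congr pair; apply/permP => k.
by apply: (@lift_inj _ p); rewrite -!(lift_perm_lift ord0) eq_st.
Qed.

Section Determinant.
Variable R : pzRingType.

Lemma col_det_tr r (M : 'M[R]_r) : col_det M = \det M^T.
Proof.
by apply: eq_bigr => s _; congr (_ * _); apply: eq_bigr => k _; rewrite mxE.
Qed.

Lemma det_expand0 r (N : 'M[R]_r.+1) :
  \det N = \sum_(p < r.+1) (-1) ^+ p * (N ord0 p * \det (row' ord0 (col' p N))).
Proof.
rewrite /determinant (reindex _ (onW_bij _ (lift_perm0_bij r))) /=.
rewrite -(pair_bigA _ (fun p s => (-1) ^+ lift_perm ord0 p s
  * \prod_i N i (lift_perm ord0 p s i))) /=.
apply: eq_bigr => p _; rewrite !big_distrr /=; apply: eq_bigr => s _.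
rewrite odd_lift_perm /= signr_addb signr_odd -!mulrA; congr (_ * _).
rewrite big_ord_recl lift_perm_id [RHS]mulrA (commr_sign (N ord0 p)) -mulrA.
by congr (_ * (_ * _)); apply: eq_bigr => i _; rewrite lift_perm_lift !mxE.
Qed.

(** The commutation relation between distinct rows under which the ordered
    determinant is antisymmetric.  The relation and its consequences are
    multiplied by [c], since the row of [h] satisfies it only for [c = 2]; the
    case [c = 1] is the plain relation. *)
Definition exchangeable_rows (c r n : nat) (N : 'M[R]_(r, n)) : Prop :=
  forall a b p q, a != b ->
    rbracket (N a p) (N b q) *+ c = rbracket (N a q) (N b p) *+ c.

(** The permutations are paired by composition with the transposition of the
    first two indices.  Pairing them, instead of comparing the whole sum with
    its own opposite, keeps the multiple [c] from being doubled. *)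
Lemma det_swap01 c r (N : 'M[R]_r.+2) : exchangeable_rows c N ->
  \det (xrow ord0 (lift ord0 ord0) N) *+ c = - \det N *+ c.
Proof.
set i1 := lift _ _ => exN; apply/eqP; rewrite mulNrn -subr_eq0 opprK; apply/eqP.
rewrite -mulrnDl -big_split /= (bigID (fun s : 'S__ => s ord0 < s i1)%N) /=.
have t_bij: bijective (mulg (tperm ord0 i1)) by apply: injF_bij; apply: mulgI.
rewrite [X in _ + X](reindex _ (onW_bij _ t_bij)) /=.
rewrite [X in _ + X](eq_bigl (fun s : 'S__ => s ord0 < s i1)%N); last first.
  move=> s; rewrite !permM tpermL tpermR -leqNgt leq_eqVlt.
  by rewrite val_eqE (inj_eq perm_inj).
rewrite -big_split -sumrMnl big1 // => s _ /=.
rewrite odd_permM odd_tperm /= (signr_addb R true) mulN1r.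
have tK k : tperm ord0 i1 (lift ord0 (lift ord0 k)) = lift ord0 (lift ord0 k).
  by rewrite tpermD // -val_eqE.
rewrite !mulNr -!opprD -!mulrDr -mulrBr -mulrnAr.
rewrite !big_ord_recl !mxE !permM -/i1 tpermL tpermR.
set T := \prod_(i < r) N (lift ord0 (lift ord0 i)) (s (lift ord0 (lift ord0 i))).
have T1 : \prod_(i < r) xrow ord0 i1 N (lift ord0 (lift ord0 i))
    (s (lift ord0 (lift ord0 i))) = T.
  by apply: eq_bigr => i _; rewrite mxE tK.
have T2 : \prod_(i < r) N (lift ord0 (lift ord0 i))
    ((tperm ord0 i1 * s)%g (lift ord0 (lift ord0 i))) = T.
  by apply: eq_bigr => i _; rewrite permM tK.
have T3 : \prod_(i < r) xrow ord0 i1 N (lift ord0 (lift ord0 i))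
    ((tperm ord0 i1 * s)%g (lift ord0 (lift ord0 i))) = T.
  by apply: eq_bigr => i _; rewrite mxE permM !tK.
rewrite {}T1 {}T2 {}T3 !mulrA -!mulrDl -mulrBl -mulrnAl.
have := exN ord0 i1 (s ord0) (s i1) isT; rewrite /rbracket => exs.
rewrite [X in X - _]addrC opprD addrACA mulrnDl exs -mulrnDl -opprB addNr.
by rewrite mul0rn mul0r mulr0.
Qed.

(** The permutations that fix the first index reduce to smaller ones by
    expansion along the first row, and every other permutation is a product of
    such permutations and of the exchange of the first two rows. *)
Lemma det_row_perm c r (N : 'M[R]_r) (s : 'S_r) : exchangeable_rows c N ->
  \det (row_perm s N) *+ c = (-1) ^+ s * \det N *+ c.
Proof.
elim: r N s => [|r IHr] N s exN.
  have -> : s = 1%g by apply/permP => -[].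
  by rewrite row_perm1 odd_perm1 mul1r.
have fix0 (u : 'S_r.+1) (P : 'M[R]_r.+1) : exchangeable_rows c P ->
    u ord0 = ord0 -> \det (row_perm u P) *+ c = (-1) ^+ u * \det P *+ c.
  move=> exP; have [f _ fK] := lift_perm0_bij r.
  rewrite -(fK u); case: (f u) => p v /=; rewrite lift_perm_id => ->.
  rewrite odd_lift_perm /= !det_expand0 mulr_sumr -!sumrMnl.
  apply: eq_bigr => q _; rewrite mxE lift_perm_id.
  have -> : row' ord0 (col' q (row_perm (lift_perm ord0 ord0 v) P)) =
            row_perm v (row' ord0 (col' q P)).
    by apply/matrixP => i j; rewrite !mxE lift_perm_lift.
  rewrite -2!mulrnAr IHr.
    rewrite !mulrnAr; congr (_ *+ c).
    rewrite [P _ _ * _]mulrA (commr_sign (P _ _)) -mulrA mulrA.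
    by rewrite (commr_sign ((-1) ^+ q)) -mulrA.
  by move=> a b p' q' ab; rewrite !mxE exP ?(inj_eq lift_inj).
case: r s N exN IHr fix0 => [|r] s N exN _ fix0.
  by apply: fix0 => //; rewrite !ord1.
case: (unliftP ord0 (s ord0)) => [a|] s0; last exact: fix0.
(* [u] is built to fix [ord0]: it sends [ord0] to [s ord0], then to [i1], then
   back to [ord0]; and [v] fixes [ord0] because [s ord0] is not [ord0]. *)
pose i1 : 'I_r.+2 := lift ord0 ord0; pose t := tperm ord0 i1.
pose v := tperm (s ord0) i1; pose u := (s * v * t)%g.
have -> : s = (u * (t * v))%g.
  by rewrite /u !mulgA -(mulgA _ t t) tperm2 mulg1 -mulgA tperm2 mulg1.
have exP (w : 'S_r.+2) : exchangeable_rows c (row_perm w N).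
  by move=> a' b p q ab; rewrite !mxE exN ?(inj_eq perm_inj).
rewrite row_permM fix0; [|exact: exP|by rewrite !permM tpermL tpermR].
rewrite -mulrnAr row_permM -/(xrow ord0 i1 _) (det_swap01 (exP v)).
rewrite mulNrn fix0 //; last by rewrite tpermD // s0 eq_sym neq_lift.
have -> : odd_perm (u * (t * v)) = u (+) ~~ v.
  by rewrite (odd_permM u) (odd_permM t) (odd_tperm ord0 i1).
by rewrite signr_addb signrN -mulrA mulNr mulrN mulrN mulNrn mulrnAr.
Qed.

Lemma det_eq_rows r (N : 'M[R]_r) (a b : 'I_r) :
  exchangeable_rows 1 N -> a != b -> row a N = row b N -> \det N *+ 2 = 0.
Proof.
move=> exN ab Nab; have := det_row_perm (tperm a b) exN.
have -> : row_perm (tperm a b) N = N.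
  apply/matrixP => k q; rewrite mxE; move/rowP/(_ q): Nab; rewrite !mxE => Nab.
  by case: tpermP => // ->.
by rewrite odd_tperm ab expr1 !mulr1n mulN1r mulr2n => {1}->; rewrite addNr.
Qed.

(** [x |-> rbracket x b] is a derivation. *)
Lemma bracket_prod r (F : 'I_r -> R) b :
  rbracket (\prod_k F k) b
  = \sum_k \prod_i (if i == k then rbracket (F i) b else F i).
Proof.
elim: r F => [|r IHr] F.
  by rewrite !big_ord0 /rbracket mul1r mulr1 subrr.
have bracketM x y : rbracket (x * y) b = rbracket x b * y + x * rbracket y b.
  by rewrite /rbracket mulrBl mulrBr !mulrA [RHS]addrC addrA subrK.
rewrite big_ord_recl bracketM IHr [RHS]big_ord_recl; congr (_ + _).
  by rewrite big_ord_recl eqxx.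
rewrite mulr_sumr; apply: eq_bigr => k _; by rewrite big_ord_recl.
Qed.

Lemma bracket_det r (N : 'M[R]_r) b :
  rbracket (\det N) b
  = \sum_k \det (\matrix_(i, p) (if i == k then rbracket (N i p) b else N i p)).
Proof.
rewrite exchange_big /= /rbracket /determinant mulr_suml mulr_sumr -sumrB.
apply: eq_bigr => s _.
rewrite -mulr_sumr mulrA (commr_sign b) -!mulrA -mulrBr; congr (_ * _).
rewrite -/(rbracket _ b) bracket_prod; apply: eq_bigr => k _.
by apply: eq_bigr => i _; rewrite mxE.
Qed.

Lemma det_row_scale r (N : 'M[R]_r) k z : (forall x, GRing.comm z x) ->
  \det (\matrix_(i, p) ((if i == k then z else 1) * N i p)) = z * \det N.
Proof.
move=> zC; rewrite mulr_sumr; apply: eq_bigr => s _.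
rewrite mulrA zC -mulrA; congr (_ * _); under eq_bigr do rewrite mxE.
rewrite prodrM_comm => [|i j _ _]; last first.
  by case: eqP => _; [apply: zC | apply/commr_sym/commr1].
by rewrite -big_mkcond big_pred1_eq.
Qed.

End Determinant.

(** * Moving the entries of B through the determinant *)

Definition cons0 (T : Type) (r : nat) (x : T) (f : 'I_r -> T) (k : 'I_r.+1) : T :=
  oapp f x (unlift ord0 k).

Lemma cons0_0 T r x (f : 'I_r -> T) : cons0 x f ord0 = x.
Proof. by rewrite /cons0 unlift_none. Qed.

Lemma cons0_lift T r x (f : 'I_r -> T) k : cons0 x f (lift ord0 k) = f k.
Proof. by rewrite /cons0 liftK. Qed.

Lemma sum_ffun_cons0 (T : finType) (V : nmodType) r (F : {ffun 'I_r.+1 -> T} -> V) :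
  \sum_l F l = \sum_(l : {ffun 'I_r -> T}) \sum_x F (finfun (cons0 x l)).
Proof.
rewrite pair_bigA /= (reindex (fun u : {ffun 'I_r -> T} * T => finfun (cons0 u.2 u.1))) //.
exists (fun l : {ffun 'I_r.+1 -> T} => ([ffun k => l (lift ord0 k)], l ord0)).
  case=> l x _ /=; congr pair; last by rewrite ffunE cons0_0.
  by apply/ffunP => k; rewrite !ffunE cons0_lift.
move=> l _; apply/ffunP => k; rewrite ffunE /=.
by case: (unliftP ord0 k) => [a|] ->; rewrite ?cons0_lift ?cons0_0 ?ffunE.
Qed.

Section CapelliCommutation.
Variables (R : pzRingType) (m n : nat) (A B : 'M[R]_(m, n)) (h : 'M[R]_n).
Hypothesis AB_bracket : forall (i k : 'I_m) (j l : 'I_n),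
  rbracket (A i j) (B k l) = - (if i == k then h j l else 0).
Hypothesis A_sym : column_symmetric_commutators A.

Lemma exchangeable_mxsub r s (l : 'I_r -> 'I_m) (i : 'I_s -> 'I_n) :
  exchangeable_rows 1 (mxsub l i A).
Proof. by move=> a b p q _; rewrite !mxE A_sym. Qed.

(** [h j s] is minus the commutator of [A k j] with [B k s], so, by the Jacobi
    identity, the difference of the two sides is twice the commutator of
    [B k s] with [rbracket (A k j) (A k l)].  By symmetry the latter is equal
    to its own opposite, hence is killed by 2 but need not vanish. *)
Lemma bracket_h_exchange (k : 'I_m) (j l s : 'I_n) :
  rbracket (A k j) (h l s) *+ 2 = rbracket (A k l) (h j s) *+ 2.
Proof.
have hE q : h q s = - rbracket (A k q) (B k s) by rewrite AB_bracket eqxx opprK.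
have Akk : rbracket (A k j) (A k l) *+ 2 = 0.
  by rewrite mulr2n {1}A_sym /rbracket addrA subrK subrr.
apply/eqP; rewrite -subr_eq0 -mulrnBl !hE; apply/eqP.
transitivity (rbracket (B k s) (rbracket (A k j) (A k l) *+ 2)); last first.
  by rewrite Akk /rbracket mulr0 mul0r subrr.
(* What remains once the factor 2 is removed is the Jacobi identity. *)
have -> x y : rbracket x (y *+ 2) = rbracket x y *+ 2.
  by rewrite /rbracket mulrnAr mulrnAl -mulrnBl.
congr (_ *+ 2); rewrite /rbracket !opprB !mulrBr !mulrBl !mulrA !opprB.
rewrite addrACA [X in X + _]addrC [X in _ + X]addrC !addrA !subrK.
by rewrite -!addrA; congr (_ + _); rewrite addrCA [RHS]addrCA [X in _ + X]addrC.
Qed.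

Lemma bracket_det_mxsub r (l : 'I_r -> 'I_m) (i : 'I_r -> 'I_n) (k : 'I_m) (j : 'I_n) :
  rbracket (\det (mxsub l i A)) (B k j)
  = - \sum_(a | l a == k)
       \det (\matrix_(b, p) (if b == a then h (i p) j else A (l b) (i p))).
Proof.
rewrite bracket_det -sumrN [RHS]big_mkcond; apply: eq_bigr => a _.
set N := \matrix_(b, p) (if b == a then h (i p) j else A (l b) (i p)).
transitivity (- (l a == k)%:R * \det N); last first.
  by case: eqP; rewrite ?mulN1r // oppr0 mul0r.
rewrite -(@det_row_scale _ _ _ a); last first.
  by move=> x; apply/commr_sym/commrN/commr_nat.
congr (\det _); apply/matrixP => b p; rewrite !mxE.
have [->|_] := eqVneq b a; last by rewrite mul1r.
by rewrite AB_bracket; case: eqP; rewrite ?mulN1r // oppr0 mul0r.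
Qed.

(** One step of the induction: a whole column of [B] is absorbed into the first
    row of the determinant, and each of the [r] rows that it crosses
    contributes one copy of [h]. *)
Lemma det_mxsub_mulB r (l : 'I_r -> 'I_m) (i : 'I_r.+1 -> 'I_n) (j : 'I_n) :
  (\sum_k \det (mxsub (cons0 k l) i A) * B k j) *+ 2
  = (\sum_(p < r.+1) (-1) ^+ p * ((A^T *m B) (i p) j + h (i p) j *+ r)
       * \det (mxsub l (i \o lift p) A)) *+ 2.
Proof.
have minor_cons k p :
    row' ord0 (col' p (mxsub (cons0 k l) i A)) = mxsub l (i \o lift p) A.
  by apply/matrixP => a b; rewrite !mxE cons0_lift.
(* All the crossing terms are [N] with the row of [h] exchanged with another. *)
pose N := \matrix_(b, q) cons0 (h (i q) j) (fun a => A (l a) (i q)) b.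
have det_N : \det N = \sum_(p < r.+1) (-1) ^+ p * h (i p) j * \det (mxsub l (i \o lift p) A).
  rewrite det_expand0; apply: eq_bigr => p _; rewrite mxE cons0_0 mulrA.
  by congr (_ * \det _); apply/matrixP => a b; rewrite !mxE cons0_lift.
have exN : exchangeable_rows 2 N.
  move=> a b p q; rewrite !mxE.
  case: (unliftP ord0 a) => [a'|] ->; case: (unliftP ord0 b) => [b'|] -> ab;
    rewrite ?cons0_0 ?cons0_lift //.
  - by rewrite A_sym.
  - exact: bracket_h_exchange.
  have anti (x y : R) : rbracket x y = - rbracket y x by rewrite /rbracket opprB.
  by rewrite !(anti (h _ _)) !mulNrn bracket_h_exchange.
have swap_h (a : 'I_r) :
    (\sum_(p < r.+1) (-1) ^+ p * (A (l a) (i p) * \det (\matrix_(b, q)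
      (if b == a then h (i (lift p q)) j else A (l b) (i (lift p q)))))) *+ 2
    = - \det N *+ 2.
  transitivity (\det (row_perm (tperm ord0 (lift ord0 a)) N) *+ 2); last first.
    by rewrite det_row_perm // odd_tperm neq_lift expr1 mulN1r.
  rewrite det_expand0; congr (_ *+ 2); apply: eq_bigr => p _.
  rewrite !mxE tpermL cons0_lift; congr (_ * (_ * \det _)).
  apply/matrixP => b q; rewrite !mxE.
  have [->|ba] := eqVneq b a; first by rewrite tpermR cons0_0.
  by rewrite tpermD ?cons0_lift ?neq_lift // (inj_eq lift_inj) eq_sym.
pose D p := \det (mxsub l (i \o lift p) A).
have move_B : \sum_k \det (mxsub (cons0 k l) i A) * B k j
    = \sum_(p < r.+1) (-1) ^+ p * (A^T *m B) (i p) j * D p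
      + \sum_k \sum_(p < r.+1) (-1) ^+ p * (A k (i p) * rbracket (D p) (B k j)).
  have -> : \sum_(p < r.+1) (-1) ^+ p * (A^T *m B) (i p) j * D p
      = \sum_k \sum_(p < r.+1) (-1) ^+ p * (A k (i p) * (B k j * D p)).
    rewrite exchange_big; apply: eq_bigr => p _.
    rewrite mxE -mulrA mulr_suml mulr_sumr; apply: eq_bigr => k _.
    by rewrite mxE -!mulrA.
  rewrite -big_split; apply: eq_bigr => k _ /=.
  rewrite det_expand0 mulr_suml -big_split; apply: eq_bigr => p _ /=.
  rewrite minor_cons mxE cons0_0 -mulrDr -mulrDr -!mulrA -/(D p).
  by rewrite /rbracket addrC subrK.
have sum_bracket : (\sum_k \sum_(p < r.+1)
    (-1) ^+ p * (A k (i p) * rbracket (D p) (B k j))) *+ 2 = \det N *+ r *+ 2.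
  transitivity (\sum_(a < r) \det N *+ 2); last first.
    by rewrite sumr_const card_ord mulrnAC.
  rewrite (partition_big l predT) //= -sumrMnl; apply: eq_bigr => k _.
  transitivity (\sum_(a | l a == k) - (\sum_(p < r.+1) (-1) ^+ p *
      (A (l a) (i p) * \det (\matrix_(b, q)
        (if b == a then h (i (lift p q)) j else A (l b) (i (lift p q)))))) *+ 2).
    rewrite sumrMnl sumrN exchange_big -sumrN; congr (_ *+ 2).
    apply: eq_bigr => p _; rewrite bracket_det_mxsub mulrN mulrN !mulr_sumr.
    by congr (- _); apply: eq_bigr => a /eqP ->.
  by apply: eq_bigr => a _; rewrite mulNrn swap_h mulNrn opprK.
rewrite move_B mulrnDl sum_bracket -mulrnDl; congr (_ *+ 2).
rewrite det_N -sumrMnl -big_split; apply: eq_bigr => p _ /=.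
by rewrite mulrDr mulrDl mulrnAr mulrnAl.
Qed.

(** The Cauchy-Binet sum over all index sequences, including those with
    repetitions, and for arbitrary [i] and [j]; the induction removes one
    entry from each. *)
Lemma sum_det_mulB r (i j : 'I_r -> 'I_n) :
  (\sum_(l : {ffun 'I_r -> 'I_m}) \det (mxsub l i A) * \prod_b B (l b) (j b)) *+ 2
  = col_det (\matrix_(p, b) ((A^T *m B) (i p) (j b) + h (i p) (j b) *+ (r - b.+1))) *+ 2.
Proof.
have det0 (M : 'M[R]_0) : \det M = 1.
  rewrite /determinant (big_pred1 1%g) => [|t]; last first.
    by apply/esym/eqP/permP => -[].
  by rewrite odd_perm1 big_ord0 mulr1.
elim: r i j => [|r IHr] i j.
  rewrite col_det_tr det0 (eq_bigr (fun=> 1)) => [|l _]; last first.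
    by rewrite det0 big_ord0 mulr1.
  by rewrite sumr_const card_ffun !card_ord expn0.
rewrite sum_ffun_cons0 col_det_tr det_expand0.
transitivity (\sum_(l : {ffun 'I_r -> 'I_m})
   ((\sum_k \det (mxsub (cons0 k l) i A) * B k (j ord0)) *+ 2
     * \prod_b B (l b) (j (lift ord0 b)))).
  rewrite -sumrMnl; apply: eq_bigr => l _; rewrite mulrnAl mulr_suml.
  congr (_ *+ 2); apply: eq_bigr => k _.
  rewrite big_ord_recl ffunE cons0_0 -mulrA; congr (_ * (_ * _)).
    by congr (\det _); apply/matrixP => a b; rewrite !mxE ffunE.
  by apply: eq_bigr => b _; rewrite ffunE cons0_lift.
under eq_bigr do rewrite det_mxsub_mulB mulrnAl mulr_suml -sumrMnl.
rewrite exchange_big -sumrMnl; apply: eq_bigr => p _ /=.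
set M := \matrix_(_, _) _.
have -> : row' ord0 (col' p M^T) = (\matrix_(q, b)
    ((A^T *m B) ((i \o lift p) q) ((j \o lift ord0) b)
     + h ((i \o lift p) q) ((j \o lift ord0) b) *+ (r - b.+1)))^T.
  by apply/matrixP => b q; rewrite !mxE.
rewrite sumrMnl -col_det_tr -!mulrnAr -IHr !mulrnAr mulrA mulr_sumr.
congr (_ *+ 2); apply: eq_bigr => l _.
by rewrite !mxE subSS subn0 !mulrA.
Qed.

End CapelliCommutation.

(** * From index sequences to subsets *)

Lemma elt_inj n r (L : rsubset n r) : injective (elt L).
Proof. by move=> a b /enum_val_inj /cast_ord_inj. Qed.

Lemma elt_surj n r (L : rsubset n r) x : x \in val L -> exists a, x = elt L a.
Proof.
move=> xL; exists (cast_ord (eqP (valP L)) (enum_rank_in xL x)).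
by rewrite /elt cast_ordK enum_rankK_in.
Qed.

(** Composing the increasing enumeration of [L] with a permutation is injective
    in the pair, and the counts [C(m, r) * r!] and [m ^_ r] agree, so every
    injective sequence arises. *)
Lemma sum_injective_ffun (V : nmodType) m r (F : {ffun 'I_r -> 'I_m} -> V) :
  \sum_(l : {ffun 'I_r -> 'I_m} | injectiveb l) F l
  = \sum_(L : rsubset m r) \sum_(s : 'S_r) F [ffun k => elt L (s k)].
Proof.
pose f (u : rsubset m r * 'S_r) : {ffun 'I_r -> 'I_m} := [ffun k => elt u.1 (u.2 k)].
have f_inj : injective f.
  case=> [L s] [L' s'] /ffunP fE; have {}fE k : elt L (s k) = elt L' (s' k).
    by have := fE k; rewrite !ffunE.
  have LL' : L = L'.
    apply/val_inj/eqP; rewrite eqEcard (eqP (valP L)) (eqP (valP L')) leqnn andbT.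
    apply/subsetP => x /elt_surj [a ->].
    by rewrite -(permKV s a) fE enum_valP.
  rewrite -LL' in fE *; congr pair; apply/permP => k.
  exact: elt_inj (fE k).
have f_img : f @: predT = [set l : {ffun 'I_r -> 'I_m} | injectiveb l].
  apply/eqP; rewrite eqEcard card_imset // card_inj_ffuns !card_ord card_prod.
  rewrite card_sig -cardsE card_draws card_Sn card_ord bin_ffact leqnn andbT.
  apply/subsetP => _ /imsetP [[L s] _ ->]; rewrite inE; apply/injectiveP => a b.
  by rewrite !ffunE => /elt_inj /perm_inj.
rewrite pair_bigA -[RHS](big_imset (h := f) (A := predT)) /=; last exact: in2W.
by apply: eq_bigl => l; rewrite f_img inE.
Qed.

(** * Passage to the converse ring *)

Lemma prod_converse (R : pzRingType) r (F : 'I_r -> R) :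
  \prod_(k < r) (F k : R^c) = \prod_(k < r) F (rev_ord k) :> R.
Proof.
elim: r F => [|r IHr] F; first by rewrite !big_ord0.
rewrite big_ord_recl big_ord_recr /=.
have -> : rev_ord ord_max = ord0 :> 'I_r.+1 by apply: val_inj; rewrite /= subnn.
rewrite [LHS]/(_ * F ord0)%R; congr (_ * _); rewrite IHr; apply: eq_bigr => k _.
by congr F; apply: val_inj; rewrite /= /bump leq0n add1n subSS subnSK.
Qed.

(** Multiplication in [R^c] reverses the order of the rows; reversing the columns
    as well conjugates the permutations and so leaves the signs unchanged. *)
Lemma det_converse (R : pzRingType) r (N : 'M[R]_r) :
  @determinant R^c r N = row_det (mxsub (@rev_ord r) (@rev_ord r) N).
Proof.
pose w : 'S_r := perm (@rev_ord_inj r).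
rewrite /row_det (reindex (fun s : 'S_r => s ^ w)%g) /=; last first.
  by apply: onW_bij; exists (fun s => s ^ w^-1)%g => s; rewrite ?conjgK ?conjgKV.
apply: eq_bigr => s _.
rewrite odd_permJ -(@commr_sign R^c) prod_converse.
transitivity (((-1 : R^c) ^+ s : R) * \prod_(k < r) N (rev_ord k) (s (rev_ord k))) => //.
rewrite revrX; congr (_ * _); apply: eq_bigr => k _.
have wE a : w a = rev_ord a by rewrite permE.
rewrite mxE -[X in (s ^ w)%g X](rev_ordK k) -!wE permJ.
by rewrite !wE !rev_ordK.
Qed.

(** * The noncommutative Cauchy-Binet formula *)

Section CauchyBinet.
Variables (R : pzRingType) (m n : nat) (A B : 'M[R]_(m, n)) (h : 'M[R]_n).
Hypothesis AB_bracket : forall (i k : 'I_m) (j l : 'I_n),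
  rbracket (A i j) (B k l) = - (if i == k then h j l else 0).
Hypothesis A_sym : column_symmetric_commutators A.

(** The rows of a minor may be listed in any order [w], as both determinants
    change by the same sign; the row version uses the decreasing order. *)
Lemma capelli_cauchy_binet r (w : 'S_r) (i j : 'I_r -> 'I_n) :
  (\sum_(L : rsubset m r)
      \det (mxsub (elt L \o w) i A) * col_det (mxsub (elt L \o w) j B)) *+ 2
  = col_det (\matrix_(p, b) ((A^T *m B) (i p) (j b) + h (i p) (j b) *+ (r - b.+1))) *+ 2.
Proof.
rewrite -sum_det_mulB // (bigID (fun l : {ffun 'I_r -> 'I_m} => injectiveb l)) /= mulrnDl.
rewrite [X in _ = _ + X *+ 2]big_mkcond /= -[X in _ = _ + X]sumrMnl.
rewrite [X in _ = _ + X]big1 ?addr0 => [|l _]; last first.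
  case: ifP => [/injectivePn [a [b ab lab]]|_]; last exact: mul0rn.
  rewrite -mulrnAl (@det_eq_rows _ _ _ a b) ?mul0r //.
    exact: exchangeable_mxsub.
  by apply/rowP => q; rewrite !mxE lab.
rewrite sum_injective_ffun; congr (_ *+ 2); apply: eq_bigr => L _.
rewrite (reindex_inj (mulIg w)) /= mulr_sumr; apply: eq_bigr => s _.
rewrite mulrA (commr_sign (\det _)).
have -> : \det (mxsub [ffun k => elt L ((s * w)%g k)] i A)
    = (-1) ^+ s * \det (mxsub (elt L \o w) i A).
  rewrite -[RHS](det_row_perm (c := 1)); last exact: exchangeable_mxsub.
  by congr (\det _); apply/matrixP => a q; rewrite !mxE ffunE permM.
by congr (_ * _); apply: eq_bigr => b _; rewrite mxE ffunE permM.
Qed.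
End CauchyBinet.

Theorem proposition3p8 (R : pzRingType) (m n : nat) (A B : 'M[R]_(m, n))
    (h : 'M[R]_n)
    (hAB : forall (i k : 'I_m) (j l : 'I_n),
        rbracket (A i j) (B k l) = - (if i == k then h j l else 0))
    (r : nat) (hr1 : (1 <= r)%N) (hrn : (r <= n)%N) (I J : rsubset n r) :
  (column_symmetric_commutators A ->
     2 * \sum_(L : rsubset m r)
           col_det (submat A^T I L) * col_det (submat B L J)
     = 2 * col_det (submat (A^T *m B) I J + Qcol h I J))
  /\
  (column_symmetric_commutators B ->
     2 * \sum_(L : rsubset m r)
           row_det (submat A^T I L) * row_det (submat B L J)
     = 2 * row_det (submat (A^T *m B) I J + Qrow h I J)).
Proof.
split=> symm; rewrite !mulr_natl.
  have := capelli_cauchy_binet hAB symm 1%g (elt I) (elt J).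
  have -> : (\matrix_(p, b) ((A^T *m B) (elt I p) (elt J b)
      + h (elt I p) (elt J b) *+ (r - b.+1))) = submat (A^T *m B) I J + Qcol h I J.
    by apply/matrixP => a b; rewrite !mxE.
  move=> <-; congr (_ *+ 2); apply: eq_bigr => L _; congr (_ * _).
    by apply: eq_bigr => s _; congr (_ * _); apply: eq_bigr => k _; rewrite !mxE /= perm1.
  by congr (col_det _); apply/matrixP => a b; rewrite !mxE /= perm1.
have hBA (i k : 'I_m) (j l : 'I_n) :
  @rbracket R^c (B i j) (A k l) = - (if i == k then h^T j l else 0).
  by rewrite mxE eq_sym -hAB.
have symc : @column_symmetric_commutators R^c m n B.
  by move=> i k j l; exact: symm k i l j.
pose w : 'S_r := perm (@rev_ord_inj r).
have det_B L : @determinant R^c r (mxsub (elt L \o w) (elt J \o @rev_ord r) B)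
    = row_det (submat B L J).
  rewrite det_converse; apply: (congr1 (@row_det R r)); apply/matrixP => a b.
  by rewrite !mxE /= permE !rev_ordK.
have det_A L : @col_det R^c r (mxsub (elt L \o w) (elt I \o @rev_ord r) A)
    = row_det (submat A^T I L).
  rewrite col_det_tr det_converse; apply: (congr1 (@row_det R r)); apply/matrixP => a b.
  by rewrite !mxE /= permE !rev_ordK.
have := capelli_cauchy_binet hBA symc w (elt J \o @rev_ord r) (elt I \o @rev_ord r).
rewrite col_det_tr det_converse => detE.
transitivity (\sum_(L : rsubset m r)
    (@determinant R^c r (mxsub (elt L \o w) (elt J \o @rev_ord r) B)
     * @col_det R^c r (mxsub (elt L \o w) (elt I \o @rev_ord r) A) : R^c) *+ 2).
  by rewrite -sumrMnl; apply: eq_bigr => L _; rewrite det_B det_A.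
rewrite sumrMnl; apply: (etrans detE).
apply: (congr1 (fun M => @row_det R r M *+ 2)); apply/matrixP => a b; rewrite !mxE /= !rev_ordK.
congr (_ + _ *+ _); last by rewrite /= subnSK ?subKn // ltnW.
by apply: eq_bigr => k _; rewrite !mxE.
Qed.
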